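(* Let $\{(x_i,y_i): i=1,2,\dots,N\}$ be convex (respectively concave) data with $\Delta_1<\Delta_2<\dots<\Delta_{N-1}$ (respectively with all inequalities reversed), and assume that the derivative parameters satisfy the necessary convexity condition $d_1<\Delta_1<d_2<\Delta_2<\dots<\Delta_{N-1}<d_N$ (respectively the concavity condition with all inequalities reversed). Then the following conditions on the scaling factors and the shape parameters, for every $i\in J$, are sufficient for the corresponding $\mathcal{C}^1$-rational cubic spline FIF $S$ to be convex (respectively concave) on $I=[x_1,x_N]$: $$0\le\alpha_i\le\min\Big\{\kappa a_i^2,\ \kappa^*\frac{h_i(d_{i+1}-\Delta_i)}{d_N(x_N-x_1)-(y_N-y_1)},\ \kappa_*\frac{h_i(\Delta_i-d_i)}{(y_N-y_1)-d_1(x_N-x_1)}\Big\},\qquad \kappa,\kappa^*,\kappa_*\in[0,1),$$ $$r_i\ge\max\Bigg\{\frac{d_{i+1}-d_i+\frac{\alpha_i}{h_i}(x_N-x_1)(d_1-d_N)}{d_{i+1}-\Delta_i-\frac{\alpha_i}{h_i}[d_N(x_N-x_1)-(y_N-y_1)]},\ \frac{d_{i+1}-d_i+\frac{\alpha_i}{h_i}(x_N-x_1)(d_1-d_N)}{\Delta_i-d_i-\frac{\alpha_i}{h_i}[y_N-y_1-d_1(x_N-x_1)]}\Bigg\}.$$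
   Context: Let $N\ge2$, $x_1<x_2<\dots<x_N$, $I=[x_1,x_N]$, $J=\{1,\dots,N-1\}$, $h_i=x_{i+1}-x_i$, $a_i=h_i/(x_N-x_1)$, $\Delta_i=(y_{i+1}-y_i)/h_i$, and let $L_i(x)=a_ix+b_i$ be the affine map with $L_i(x_1)=x_i$, $L_i(x_N)=x_{i+1}$. Given values $y_i$, derivative parameters $d_i$ ($i=1,\dots,N$), scaling factors $\alpha_i$ with $|\alpha_i|\le\kappa a_i$ ($i\in J$, $0\le\kappa<1$) and shape parameters $r_i>-1$ ($i\in J$), the $\mathcal{C}^1$-rational cubic spline FIF is the unique function $S\in\mathcal{C}^1(I)$ satisfying, with $\theta=\frac{x-x_1}{x_N-x_1}$, $$S(L_i(x))=\alpha_iS(x)+\frac{P_i(\theta)}{Q_i(\theta)},\quad x\in I,\ i\in J,\qquad Q_i(\theta)=1+(r_i-3)\theta(1-\theta),$$ $$\begin{aligned}P_i(\theta)={}&(y_i-\alpha_iy_1)(1-\theta)^3+\{[r_iy_i+h_id_i]-\alpha_i[r_iy_1+d_1(x_N-x_1)]\}\theta(1-\theta)^2\\&+\{[r_iy_{i+1}-h_id_{i+1}]-\alpha_i[r_iy_N-d_N(x_N-x_1)]\}\theta^2(1-\theta)+(y_{i+1}-\alpha_iy_N)\theta^3.\end{aligned}$$ It satisfies $S(x_i)=y_i$ and $S^{(1)}(x_i)=d_i$ for all $i$. *)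

(* Defs.v *)
From mathcomp Require Import all_boot all_order all_algebra.
From mathcomp Require Import all_classical all_reals all_analysis.
From mathcomp Require Import ring.
Import Order.TTheory GRing.Theory Num.Theory numFieldNormedType.Exports.

Set Implicit Arguments.
Unset Strict Implicit.
Unset Printing Implicit Defensive.

Local Open Scope classical_set_scope.
Local Open Scope ring_scope.

(* Data and parameters are sequences [nat -> R] indexed from 1: only the
   entries 1, ..., N (resp. 1, ..., N - 1 for quantities attached to a
   subinterval) are meaningful; all others are unconstrained and unused. *)

Section RationalCubicSplineFIF.
Variable R : realType.
Implicit Types (N i : nat) (x y d alpha r : nat -> R) (t theta : R).

(* i \in J = {1, ..., N - 1} *)
Definition inJ N i : bool := (1 <= i < N)%N.

Definition I_ N x : set R := `[x 1%N, x N].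

(* x_N - x_1 *)
Definition len N x : R := x N - x 1%N.

Definition h_ x i : R := x i.+1 - x i.

Definition a_ N x i : R := h_ x i / len N x.

Definition b_ N x i : R := (x N * x i - x 1%N * x i.+1) / len N x.

Definition L_ N x i t : R := a_ N x i * t + b_ N x i.

Lemma L_left N x i : len N x != 0 -> L_ N x i (x 1%N) = x i.
Proof. by rewrite /L_ /a_ /b_ /h_ /len => ?; field. Qed.

Lemma L_right N x i : len N x != 0 -> L_ N x i (x N) = x i.+1.
Proof. by rewrite /L_ /a_ /b_ /h_ /len => ?; field. Qed.

Definition Delta_ x y i : R := (y i.+1 - y i) / h_ x i.

Definition Q_ r i theta : R := 1 + (r i - 3) * theta * (1 - theta).

Definition P_ N x y d alpha r i theta : R :=
    (y i - alpha i * y 1%N) * (1 - theta) ^+ 3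
  + ((r i * y i + h_ x i * d i)
     - alpha i * (r i * y 1%N + d 1%N * len N x)) * theta * (1 - theta) ^+ 2
  + ((r i * y i.+1 - h_ x i * d i.+1)
     - alpha i * (r i * y N - d N * len N x)) * theta ^+ 2 * (1 - theta)
  + (y i.+1 - alpha i * y N) * theta ^+ 3.

(* Derivatives are taken relative to A, so they are one-sided at the end points
   of a closed interval, and values of f outside A play no role. *)
Definition C1_on (A : set R) (f : R -> R) : Prop :=
  exists f' : R -> R,
    (forall u, A u ->
       (f t - f u) / (t - u) @[t --> within A u^'] --> f' u) /\
    {within A, continuous f'}.

(* For admissible parameters (x increasing, |alpha_i| <= kappa a_i with
   kappa < 1, r_i > -1) these two properties determine S on I uniquely; the
   interpolation properties S(x_i) = y_i and S'(x_i) = d_i follow from them. *)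
Definition is_rational_cubic_FIF N x y d alpha r (S : R -> R) : Prop :=
  C1_on (I_ N x) S /\
  forall i t, inJ N i -> I_ N x t ->
    let theta := (t - x 1%N) / len N x in
    S (L_ N x i t) = alpha i * S t + P_ N x y d alpha r i theta / Q_ r i theta.

(* Delta_1 < ... < Delta_{N-1} *)
Definition convex_data N x y : Prop :=
  forall i, (1 <= i)%N -> (i.+1 < N)%N -> Delta_ x y i < Delta_ x y i.+1.

Definition concave_data N x y : Prop :=
  forall i, (1 <= i)%N -> (i.+1 < N)%N -> Delta_ x y i.+1 < Delta_ x y i.

(* d_1 < Delta_1 < d_2 < ... < Delta_{N-1} < d_N *)
Definition convex_slopes N x y d : Prop :=
  forall i, inJ N i -> d i < Delta_ x y i < d i.+1.

Definition concave_slopes N x y d : Prop :=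
  forall i, inJ N i -> d i.+1 < Delta_ x y i < d i.

Definition alpha_bound N x y d (kappa kappaU kappaL : R) i : R :=
  Num.min (kappa * a_ N x i ^+ 2)
    (Num.min
      (kappaU * (h_ x i * (d i.+1 - Delta_ x y i)
                 / (d N * len N x - (y N - y 1%N))))
      (kappaL * (h_ x i * (Delta_ x y i - d i)
                 / ((y N - y 1%N) - d 1%N * len N x)))).

Definition r_bound N x y d alpha i : R :=
  let num := d i.+1 - d i + alpha i / h_ x i * len N x * (d 1%N - d N) in
  Num.max
    (num / (d i.+1 - Delta_ x y i
            - alpha i / h_ x i * (d N * len N x - (y N - y 1%N))))
    (num / (Delta_ x y i - d i
            - alpha i / h_ x i * (y N - y 1%N - d 1%N * len N x))).

Definition concave_function (D : set R^o) (f : R^o -> R^o) : Prop :=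
  convex_function D (fun t => - f t).

End RationalCubicSplineFIF.

(* Main.v *)
Require Import Defs.
From mathcomp Require Import all_boot all_order all_algebra.
From mathcomp Require Import all_classical all_reals all_analysis.
From mathcomp Require Import ring lra.
Import Order.TTheory GRing.Theory Num.Theory numFieldNormedType.Exports.

(* On each subinterval P_i / Q_i is the affine interpolant of its end values
   minus a rational "sag", whose second derivative has the sign of minus a cubic
   with Bernstein-type coefficients; the bounds on r_i make these nonnegative,
   so (P_i / Q_i)' is nondecreasing.  Differentiating the functional equation,
   S' satisfies g (L_i t) = c_i g t + q_i t with 0 <= c_i = alpha_i / a_i <=
   kappa < 1 and q_i nondecreasing, and it takes the nondecreasing values d_i at
   the nodes.  Any such continuous g is nondecreasing: the largest decrease
   g u - g v with u <= v is at most kappa times itself.  Hence S is convex; no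
   second derivative of S is needed.  The concave case follows by negating S, y
   and d. *)

Local Open Scope classical_set_scope.
Local Open Scope ring_scope.
Set Implicit Arguments.
Unset Strict Implicit.
Unset Printing Implicit Defensive.

(** * Derivatives relative to a set, and convexity from a nondecreasing derivative *)

Section DerivativeWithin.
Variable R : realType.
Implicit Types (A : set R) (f g : R -> R) (a b u v l : R).

Definition derivative_within A f u l : Prop :=
  (f t - f u) / (t - u) @[t --> within A u^'] --> l.

Lemma dnbhs_shift u : u^' = (shift u) @ (0 : R)^'.
Proof.
apply/funext => P; rewrite -[LHS]/(\forall t \near u, t != u -> P t).
rewrite -[RHS]/(\forall t \near (0 : R), t != 0 -> P (t + u)).
rewrite (near_shift 0) propeqE subr0.
by split=> Q; apply: filterS Q => t /= Pt tu; apply: Pt; move: tu; apply: contra_neq => /=; lra.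
Qed.

Lemma is_derive1P f u l :
  is_derive u 1 f l <-> (f t - f u) / (t - u) @[t --> u^'] --> l.
Proof.
have -> : (f t - f u) / (t - u) @[t --> u^'] =
    h^-1 *: ((f \o shift u) (h *: 1) - f u) @[h --> (0 : R)^'].
  rewrite dnbhs_shift -fmap_comp; apply: (congr1 (fmap^~ _)).
  by apply/funext => h /=; rewrite addrK mulrC /GRing.scale /= mulr1.
split=> [[df <-] //|fl].
by apply: DeriveDef; [move: fl; exact: cvgP | exact: cvg_lim fl].
Qed.

(** Points just to the right of [u < b] lie in the interval, so limits within it restrict to
    right-hand limits. *)
Lemma at_right_within_itv a b u : a <= u < b ->
  within `[a, b] u^' `<=` u^'+.
Proof.
move=> /andP[au ub] P uP.
have {}uP : \forall t \near u, t != u -> t \in `[a, b] -> P t.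
  exact: uP.
have ub' : \forall t \near u, t < b by exact: lt_nbhsl.
apply: filterS2 uP ub' => t /= tP tb ut; apply: tP; first by rewrite gt_eqF.
by rewrite in_itv/= !ltW// (le_lt_trans au).
Qed.

Lemma at_left_within_itv a b u : a < u <= b ->
  within `[a, b] u^' `<=` u^'-.
Proof.
move=> /andP[au ub] P uP.
have {}uP : \forall t \near u, t != u -> t \in `[a, b] -> P t.
  exact: uP.
have au' : \forall t \near u, a < t by exact: lt_nbhsr.
apply: filterS2 uP au' => t /= tP ta tu; apply: tP; first by rewrite lt_eqF.
by rewrite in_itv/= !ltW// (lt_le_trans tu).
Qed.

(** Every point of a nondegenerate interval is an accumulation point; properness makes limits, hence
    relative derivatives, unique. *)
Lemma within_itv_dnbhs_proper a b u : a < b -> a <= u <= b ->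
  ProperFilter (within `[a, b] u^').
Proof.
move=> ab /andP[au ub]; split.
  have [ub'|bu] := ltP u b.
  - move=> /(@at_right_within_itv a b u); rewrite au ub' => /(_ isT).
    exact: filter_not_empty.
  - move=> /(@at_left_within_itv a b u); rewrite ub (lt_le_trans ab bu) => /(_ isT).
    exact: filter_not_empty.
exact: within_filter.
Qed.

Lemma derivative_within_unique a b f u l l' : a < b -> a <= u <= b ->
  derivative_within `[a, b] f u l -> derivative_within `[a, b] f u l' -> l = l'.
Proof.
move=> ab abu fl fl'; have P := within_itv_dnbhs_proper ab abu.
exact: (cvg_unique _ fl fl').
Qed.

Lemma is_derive_within A f u l : is_derive u 1 f l -> derivative_within A f u l.
Proof. by move=> /is_derive1P; exact: cvg_within_filter. Qed.

Lemma derivative_within_is_derive a b f u l : u \in `]a, b[ ->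
  derivative_within `[a, b] f u l -> is_derive u 1 f l.
Proof.
rewrite in_itv/= => /andP[au ub] fl; apply/is_derive1P; apply: (@cvg_at_right_left_dnbhs _ R^o).
- by move=> P /fl; apply: at_right_within_itv; rewrite (ltW au).
- by move=> P /fl; apply: at_left_within_itv; rewrite (ltW ub) au.
Qed.

Lemma derivative_within_continuous A f u l : derivative_within A f u l ->
  f t @[t --> within A u^'] --> f u.
Proof.
move=> fl; have F : Filter (within A u^') by exact: within_filter.
have tu : t - u @[t --> within A u^'] --> 0.
  rewrite -(subrr u); apply: cvgB; last exact: cvg_cst.
  by apply: cvg_within_filter; apply: cvg_within_filter; exact: cvg_id.
have : f u + (f t - f u) / (t - u) * (t - u) @[t --> within A u^'] --> f u + l * 0.
  by apply: cvgD; [exact: cvg_cst|exact: cvgM].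
rewrite mulr0 addr0 => H; apply: cvg_trans H; apply: near_eq_cvg.
suff : \forall t \near u^', A t -> f u + (f t - f u) / (t - u) * (t - u) = f t by [].
near=> t => _; have tu0 : t != u by near: t; exact: nbhs_dnbhs_neq.
by rewrite divfK ?subr_eq0// addrC subrK.
Unshelve. all: by end_near. Qed.

Lemma derivative_within_lin A f g u k m lf lg :
  derivative_within A f u lf -> derivative_within A g u lg ->
  derivative_within A (fun t => k * f t + m * g t) u (k * lf + m * lg).
Proof.
move=> fl gl; have F : Filter (within A u^') by exact: within_filter.
have : k * ((f t - f u) / (t - u)) + m * ((g t - g u) / (t - u))
    @[t --> within A u^'] --> k * lf + m * lg.
  by apply: cvgD; apply: cvgM => //; exact: cvg_cst.
move=> H; apply: cvg_trans H; apply: near_eq_cvg; apply: nearW => t.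
by rewrite !mulrA -mulrDl; congr (_ / _); ring.
Qed.

Lemma derivative_within_affine A f u k c l : k != 0 ->
  (forall t, A t -> A (k * t + c)) ->
  derivative_within A f (k * u + c) l ->
  derivative_within A (fun t => f (k * t + c)) u (k * l).
Proof.
move=> k0 kA fl; have F : Filter (within A u^') by exact: within_filter.
(* The affine map sends small punctured neighbourhoods of [u] in [A] into those of its image; since
   [k != 0], the image point itself is avoided. *)
have kl : k * t + c @[t --> within A u^'] --> within A (k * u + c)^'.
  move=> P [e /= e0 eP]; exists (e / `|k|) => /=.
    by rewrite divr_gt0// normr_gt0.
  move=> t /=; rewrite ltr_pdivlMr ?normr_gt0// -normrM => tu tnu At.
  apply: eP => /=; last exact: kA.
  - by rewrite (_ : _ - _ = (u - t) * k)//; ring.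
  - by apply: contra_neq tnu => /addIr /(mulfI k0).
have : k * ((f (k * t + c) - f (k * u + c)) / (k * t + c - (k * u + c)))
    @[t --> within A u^'] --> k * l.
  by apply: cvgM; [exact: cvg_cst|exact: cvg_comp kl fl].
move=> H; apply: cvg_trans H; apply: near_eq_cvg.
suff : \forall t \near u^', A t -> k * ((f (k * t + c) - f (k * u + c)) / (k * t + c - (k * u + c))) =
   (f (k * t + c) - f (k * u + c)) / (t - u) by [].
near=> t => _; have tu0 : t != u by near: t; exact: nbhs_dnbhs_neq.
have tu : t - u != 0 by rewrite subr_eq0.
rewrite (_ : k * t + c - (k * u + c) = k * (t - u)); last by ring.
by field; rewrite tu.
Unshelve. all: by end_near. Qed.

Lemma eq_derivative_within A f g u l : A u -> (forall t, A t -> f t = g t) ->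
  derivative_within A f u l -> derivative_within A g u l.
Proof.
move=> Au fg; move=> H; apply: cvg_trans H; apply: near_eq_cvg.
suff : \forall t \near u^', A t -> (f t - f u) / (t - u) = (g t - g u) / (t - u) by [].
by near=> t => At; rewrite !fg.
Unshelve. all: by end_near. Qed.

Lemma derivative_within_itv_continuous a b f df : a < b ->
  (forall u, u \in `[a, b] -> derivative_within `[a, b] f u (df u)) ->
  {within `[a, b], continuous f}.
Proof.
move=> ab fdf; apply/continuous_within_itvP => //; split.
- move=> u uab; have /fdf /(derivative_within_is_derive uab) fu : u \in `[a, b].
    exact: subset_itv_oo_cc.
  exact/differentiable_continuous/derivable1_diffP/ex_derive.
- have /fdf /derivative_within_continuous fa : a \in `[a, b] by rewrite in_itv/= lexx ltW.
  by move=> P /fa; apply: at_right_within_itv; rewrite lexx.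
- have /fdf /derivative_within_continuous fb : b \in `[a, b] by rewrite in_itv/= lexx ltW.
  by move=> P /fb; apply: at_left_within_itv; rewrite lexx ab.
Qed.

Lemma convex_function_itv a b f df : a < b ->
  (forall u, u \in `[a, b] -> derivative_within `[a, b] f u (df u)) ->
  {in `[a, b] &, {homo df : u v / u <= v}} ->
  convex_function (`[a, b] : set R^o) f.
Proof.
move=> ab fdf ndf.
have fc := derivative_within_itv_continuous ab fdf.
have mvt p q : a <= p -> p <= q -> q <= b ->
    exists2 c, p <= c <= q & f q - f p = df c * (q - p).
  move=> ap pq qb; have [||c cpq ->] := @MVT_segment _ f df p q pq.
  - move=> u; rewrite in_itv/= => /andP[pu uq].
    apply: (@derivative_within_is_derive a b).
      by rewrite in_itv/= (le_lt_trans ap pu) (lt_le_trans uq qb).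
    by apply: fdf; rewrite in_itv/= (le_trans ap (ltW pu)) (le_trans (ltW uq) qb).
  - by apply: continuous_subspaceW fc; apply: subset_itv; rewrite bnd_simp.
  - by exists c => //; rewrite in_itv in cpq.
(* By the mean value theorem, the chord slopes on either side of an
   intermediate point are values of [df]. *)
have key (t p q : R) : 0 <= t <= 1 -> a <= p -> p <= q -> q <= b ->
    f (t * p + (1 - t) * q) <= t * f p + (1 - t) * f q.
  move=> /andP[t0 t1] ap pq qb; set w := t * p + _.
  have pw : p <= w by rewrite /w; nra.
  have wq : w <= q by rewrite /w; nra.
  have [c1 /andP[pc cw] e1] := mvt p w ap pw (le_trans wq qb).
  have [c2 /andP[wc cq] e2] := mvt w q (le_trans ap pw) wq qb.
  have dc : df c1 <= df c2.
    by apply: ndf; rewrite ?in_itv/=; [apply/andP; split; lra..|lra].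
  have wp : w - p = (1 - t) * (q - p) by rewrite /w; ring.
  have qw : q - w = t * (q - p) by rewrite /w; ring.
  rewrite wp in e1; rewrite qw in e2.
  (* This product is exactly the convexity gap [t * f p + (1 - t) * f q - f w]. *)
  have : 0 <= (df c2 - df c1) * (t * (1 - t) * (q - p)).
    by rewrite !mulr_ge0// subr_ge0.
  have -> : f w = t * f w + (1 - t) * f w by ring.
  have -> : f q = f w + df c2 * (t * (q - p)) by rewrite -e2; ring.
  have -> : f p = f w - df c1 * ((1 - t) * (q - p)) by rewrite -e1; ring.
  by lra.
move=> t p q; rewrite !inE /= !in_itv/= => /andP[ap pb] /andP[aq qb].
have t01 : 0 <= t%:num <= 1 by apply/andP.
have [pq|/ltW qp] := leP p q; first exact: key.
by rewrite convC [leRHS]convC; apply: key; rewrite //= subr_ge0 gerBl andbC.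
Qed.

End DerivativeWithin.

(** * The rational sag and its first two derivatives *)

Section RationalPiece.
Variables (R : realType) (r : nat -> R) (i : nat).
Hypothesis r_gtN1 : -1 < r i.
Implicit Types A B c m theta : R.

Lemma Q_gt0 theta : 0 <= theta <= 1 -> 0 < Q_ r i theta.
Proof.
move=> /andP[t0 t1].
(* A square plus a term that is positive inside the interval because [-1 < r i]; that term vanishes
   at the ends, where the square is 1. *)
have -> : Q_ r i theta = (1 - 2 * theta) ^+ 2 + (r i + 1) * (theta * (1 - theta)).
  by rewrite /Q_; ring.
have [->|tn0] := eqVneq theta 0; first by rewrite !(mulr0, mul0r) addr0 subr0 expr1n ltr01.
have [->|tn1] := eqVneq theta 1.
  by rewrite subrr !mulr0 addr0 (_ : _ ^+ 2 = 1) ?ltr01//; ring.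
have r1_gt0 : 0 < r i + 1 by move: r_gtN1; lra.
have t_gt0 : 0 < theta by rewrite lt_def tn0.
have t_lt1 : theta < 1 by rewrite lt_def eq_sym tn1.
by rewrite ltr_wpDl ?sqr_ge0// !mulr_gt0// subr_gt0.
Qed.

(** The cubic that vanishes at 0 and 1 with slopes [A] and [- B] there. *)
Definition sag_num A B theta : R :=
  theta * (1 - theta) * (A * (1 - theta) + B * theta).

Definition sag_num' A B theta : R :=
  (1 - 2 * theta) * (A * (1 - theta) + B * theta)
  + theta * (1 - theta) * (B - A).

Definition Q' theta : R := (r i - 3) * (1 - 2 * theta).

Definition sag A B theta : R := sag_num A B theta / Q_ r i theta.

Definition sag' A B theta : R :=
  (sag_num' A B theta * Q_ r i theta - sag_num A B theta * Q' theta)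
  / Q_ r i theta ^+ 2.

(** After cancellation the numerator is -2 times a cubic in Bernstein form, with coefficients
    [r i * A - (A + B)], [A], [B] and [r i * B - (A + B)]. *)
Definition sag'' A B theta : R :=
  - 2 * ((r i * A - (A + B)) * (1 - theta) ^+ 3
       + 3 * A * theta * (1 - theta) ^+ 2
       + 3 * B * theta ^+ 2 * (1 - theta)
       + (r i * B - (A + B)) * theta ^+ 3) / Q_ r i theta ^+ 3.

Lemma is_derive_div (f g : R -> R) u df dg : g u != 0 ->
  is_derive u 1 f df -> is_derive u 1 g dg ->
  is_derive u 1 (fun t => f t / g t) ((df * g u - f u * dg) / g u ^+ 2).
Proof.
move=> gu0 fu gu; apply: is_derive_eq (is_deriveM fu (is_deriveV gu0 gu)) _.
by rewrite /GRing.scale /=; field.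
Qed.

Lemma is_derive_Q theta : is_derive theta 1 (Q_ r i) (Q' theta).
Proof. by rewrite /Q_; apply: is_derive_eq; rewrite /Q' /GRing.scale /=; ring. Qed.

Lemma is_derive_Q' theta : is_derive theta 1 Q' (- 2 * (r i - 3)).
Proof. by rewrite /Q'; apply: is_derive_eq; rewrite /GRing.scale /=; ring. Qed.

Lemma is_derive_sag_num A B theta :
  is_derive theta 1 (sag_num A B) (sag_num' A B theta).
Proof.
rewrite /sag_num; apply: is_derive_eq.
by rewrite /sag_num' /GRing.scale /=; ring.
Qed.

Lemma is_derive_sag_num' A B theta :
  is_derive theta 1 (sag_num' A B)
    (- 2 * (A * (1 - theta) + B * theta) + 2 * (1 - 2 * theta) * (B - A)).
Proof.
by rewrite /sag_num'; apply: is_derive_eq; rewrite /GRing.scale /=; ring.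
Qed.

Lemma is_derive_sag A B theta : Q_ r i theta != 0 ->
  is_derive theta 1 (sag A B) (sag' A B theta).
Proof.
by move=> Q0; apply: is_derive_div => //;
  [exact: is_derive_sag_num|exact: is_derive_Q].
Qed.

Lemma is_derive_sag' A B theta : Q_ r i theta != 0 ->
  is_derive theta 1 (sag' A B) (sag'' A B theta).
Proof.
move=> Q0; have dN := is_derive_sag_num A B theta.
have dN' := is_derive_sag_num' A B theta.
have dQ := is_derive_Q theta; have dQ' := is_derive_Q' theta.
have Q20 : Q_ r i theta ^+ 2 != 0 by rewrite expf_neq0.
have dnum := is_deriveB (is_deriveM dN' dQ) (is_deriveM dN dQ').
have dden := is_deriveX 2 dQ.
apply: is_derive_eq (is_derive_div _ dnum dden) _; first exact: Q20.
rewrite !fctE /sag'' /sag_num' /sag_num /Q' /GRing.scale /=.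
by move: Q0; rewrite /Q_ => Q0; field.
Qed.

(** The four inequalities are the nonnegativity of the Bernstein coefficients in [sag'']; hence
    [sag'' <= 0], and the mean value theorem applies. *)
Lemma sag'_nincr A B : 0 <= A -> 0 <= B ->
  A + B <= r i * A -> A + B <= r i * B ->
  {in `[0, 1] &, {homo sag' A B : u v / u <= v >-> v <= u}}.
Proof.
move=> A0 B0 rA rB u v; rewrite !in_itv/= => /andP[u0 u1] /andP[v0 v1] uv.
have dd t : u <= t <= v -> is_derive t 1 (sag' A B) (sag'' A B t).
  move=> /andP[ut tv]; apply/is_derive_sag'/lt0r_neq0/Q_gt0.
  by rewrite (le_trans u0 ut) (le_trans tv v1).
have [||c cuv e] := @MVT_segment _ (sag' A B) (sag'' A B) u v uv.
- by move=> t; rewrite in_itv/= => /andP[/ltW ut /ltW tv]; apply: dd; rewrite ut tv.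
- apply: derivable_within_continuous => t; rewrite in_itv/= => /dd tuv.
  exact: ex_derive.
rewrite -subr_le0 e mulr_le0_ge0 ?subr_ge0//.
move: cuv; rewrite in_itv/= => /andP[uc cv].
have c0 : 0 <= c := le_trans u0 uc.
have c1 : c <= 1 := le_trans cv v1.
have Qc : 0 < Q_ r i c by rewrite Q_gt0// c0.
rewrite /sag'' mulNr mulNr oppr_le0 divr_ge0 ?exprn_ge0 ?(ltW Qc)//.
by rewrite mulr_ge0// !addr_ge0// ?mulr_ge0 ?exprn_ge0 ?subr_ge0.
Qed.

Lemma sag'0 A B : sag' A B 0 = A.
Proof. by rewrite /sag' /sag_num' /sag_num /Q' /Q_; field. Qed.

Lemma sag'1 A B : sag' A B 1 = - B.
Proof. by rewrite /sag' /sag_num' /sag_num /Q' /Q_; field. Qed.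

End RationalPiece.

(** * Nodes, subintervals and the affine maps [L_] *)

Section Nodes.
Variables (R : realType) (N : nat) (x : nat -> R).
Hypothesis N_ge2 : (2 <= N)%N.
Hypothesis x_incr : forall i, inJ N i -> x i < x i.+1.

(** Stated for any sequence: it serves for the nodes, for [g] at the nodes, for [d], and for [y]
    tilted by a line. *)
Lemma nondecreasing_nodes (f : nat -> R) :
  (forall i, inJ N i -> f i <= f i.+1) ->
  forall i j, (1 <= i)%N -> (i <= j)%N -> (j <= N)%N -> f i <= f j.
Proof.
move=> ndf i + i1; elim=> [|j IH]; first by rewrite leqn0 => /eqP->.
rewrite leq_eqVlt => /predU1P[-> //|ij jN].
by rewrite (le_trans (IH _ (ltnW jN)))// ndf// /inJ jN andbT (leq_trans i1).
Qed.

Lemma le_nodes i j : (1 <= i)%N -> (i <= j)%N -> (j <= N)%N -> x i <= x j.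
Proof. by apply: nondecreasing_nodes => k /x_incr /ltW. Qed.

Lemma h_gt0 i : inJ N i -> 0 < h_ x i.
Proof. by move=> iJ; rewrite subr_gt0 x_incr. Qed.

Lemma h_le_len i : inJ N i -> h_ x i <= len N x.
Proof.
by move=> /andP[i1 iN]; rewrite lerB ?le_nodes// ltnW.
Qed.

Lemma len_gt0 : 0 < len N x.
Proof.
have J1 : inJ N 1 by rewrite /inJ.
exact: lt_le_trans (h_gt0 J1) (h_le_len J1).
Qed.

Lemma len_neq0 : len N x != 0.
Proof. exact: lt0r_neq0 len_gt0. Qed.

Lemma a_gt0 i : inJ N i -> 0 < a_ N x i.
Proof. by move=> iJ; rewrite divr_gt0 ?h_gt0 ?len_gt0. Qed.

Lemma a_le1 i : inJ N i -> a_ N x i <= 1.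
Proof. by move=> iJ; rewrite ler_pdivrMr ?len_gt0// mul1r h_le_len. Qed.

Lemma L_le i t s : inJ N i -> (L_ N x i t <= L_ N x i s) = (t <= s).
Proof. by move=> iJ; rewrite lerD2r ler_pM2l ?a_gt0. Qed.

Lemma L_itv i t : inJ N i -> I_ N x t -> x i <= L_ N x i t <= x i.+1.
Proof.
rewrite /I_ /= in_itv/= => iJ /andP[t1 tN].
by rewrite -{1}(L_left i len_neq0) -(L_right i len_neq0) !L_le// t1.
Qed.

Lemma L_I i t : inJ N i -> I_ N x t -> I_ N x (L_ N x i t).
Proof.
move=> iJ tI; have /andP[xt tx] := L_itv iJ tI; have /andP[i1 iN] := iJ.
by rewrite /I_ /= in_itv/= (le_trans _ xt) ?(le_trans tx)// le_nodes// ltnW.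
Qed.

Lemma I_cover u : I_ N x u ->
  exists i t, [/\ inJ N i, I_ N x t & u = L_ N x i t].
Proof.
rewrite /I_ /= in_itv/= => /andP[xu ux].
have [i iJ /andP[iu ui]] : exists2 i, inJ N i & x i <= u <= x i.+1.
  (* Descent through the nodes: either the node before the current bound is at most [u], which
     locates [u], or that node becomes the new bound. *)
  have H n : (1 <= n)%N -> (n < N)%N -> u <= x n.+1 ->
      exists2 i, inJ N i & x i <= u <= x i.+1.
    elim: n => [//|n IH] _ nN un.
    have [xnu|/ltW unx] := leP (x n.+1) u; first by exists n.+1; rewrite ?xnu// /inJ nN.
    case: n => [|n] in IH nN un unx *; last exact: IH (ltnW nN) unx.
    by exists 1%N; rewrite ?xu// /inJ.
  have NE : N.-1.+1 = N by rewrite prednK// ltnW.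
  by apply: (H N.-1); rewrite ?NE// -ltnS NE.
have a0 := a_gt0 iJ.
have uL : u = L_ N x i ((u - b_ N x i) / a_ N x i).
  by rewrite /L_ mulrC divfK ?lt0r_neq0// subrK.
exists i, ((u - b_ N x i) / a_ N x i); split=> //.
rewrite /I_ /= in_itv/= -(L_le (x 1%N) _ iJ) -(L_le _ (x N) iJ) -uL.
by rewrite L_left ?L_right ?len_neq0// iu.
Qed.

(** * Monotonicity of continuous solutions of a self-affine equation *)

Variables (g : R -> R) (c : nat -> R) (q : nat -> R -> R) (kappa : R).
Hypothesis kappa_01 : 0 <= kappa < 1.
Hypothesis c_itv : forall i, inJ N i -> 0 <= c i <= kappa.
Hypothesis g_cont : {within I_ N x, continuous g}.
Hypothesis g_eq : forall i t, inJ N i -> I_ N x t ->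
  g (L_ N x i t) = c i * g t + q i t.
Hypothesis q_nd : forall i, inJ N i ->
  {in I_ N x &, {homo q i : u v / u <= v}}.
Hypothesis g_nodes : forall i, inJ N i -> g (x i) <= g (x i.+1).

Let I1 : I_ N x (x 1%N).
Proof. by rewrite /I_ /= in_itv/= lexx le_nodes// ltnW. Qed.

Let IN : I_ N x (x N).
Proof. by rewrite /I_ /= in_itv/= lexx le_nodes// ltnW. Qed.

Let g_left i : inJ N i -> g (x i) = c i * g (x 1%N) + q i (x 1%N).
Proof. by move=> iJ; rewrite -{1}(L_left i len_neq0) g_eq. Qed.

Let g_right i : inJ N i -> g (x i.+1) = c i * g (x N) + q i (x N).
Proof. by move=> iJ; rewrite -{1}(L_right i len_neq0) g_eq. Qed.

Let q_le i u v : inJ N i -> I_ N x u -> I_ N x v -> u <= v -> q i u <= q i v.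
Proof. by move=> iJ uI vI; apply: q_nd; rewrite ?inE. Qed.

Let x1_le u : I_ N x u -> x 1%N <= u.
Proof. by rewrite /I_ /= in_itv/= => /andP[]. Qed.

Let le_xN u : I_ N x u -> u <= x N.
Proof. by rewrite /I_ /= in_itv/= => /andP[]. Qed.

(* At a maximum point u = L_i t the functional equation gives
   g u - g x_N <= c_i (g u - g x_N) with c_i < 1. *)
Lemma self_affine_le_right u : I_ N x u -> g u <= g (x N).
Proof.
move=> uI; have [|v vI vmax] := EVT_max _ g_cont; first by rewrite le_nodes// ltnW.
apply: le_trans (vmax _ uI) _.
have [i [t [iJ tI vE]]] := I_cover vI.
have /andP[c0 ck] := c_itv iJ; have /andP[i1 iN] := iJ.
have gi : g (x i.+1) <= g (x N) by exact: (nondecreasing_nodes g_nodes).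
have qt := q_le iJ tI IN (le_xN tI).
have gv : g v = c i * g t + q i t by rewrite vE g_eq.
have gt := ler_wpM2l c0 (vmax _ tI).
have := g_right iJ => gx.
have c1 : 0 < 1 - c i by have /andP[_ k1] := kappa_01; lra.
rewrite -subr_le0 -(pmulr_rle0 _ c1); lra.
Qed.

(** At a minimum point v = L_i t the equation gives g v - g x_1 >= c_i (g v - g x_1) with c_i <
    1. *)
Lemma self_affine_ge_left u : I_ N x u -> g (x 1%N) <= g u.
Proof.
move=> uI; have [|v vI vmin] := EVT_min _ g_cont; first by rewrite le_nodes// ltnW.
apply: le_trans (vmin _ uI).
have [i [t [iJ tI vE]]] := I_cover vI.
have /andP[c0 ck] := c_itv iJ; have /andP[i1 iN] := iJ.
have gi : g (x 1%N) <= g (x i) by apply: (nondecreasing_nodes g_nodes) => //; exact: ltnW.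
have qt := q_le iJ I1 tI (x1_le tI).
have gv : g v = c i * g t + q i t by rewrite vE g_eq.
have gt := ler_wpM2l c0 (vmin _ tI).
have := g_left iJ => gx.
have c1 : 0 < 1 - c i by have /andP[_ k1] := kappa_01; lra.
rewrite -subr_le0 -(pmulr_rle0 _ c1); lra.
Qed.

(** Both terms on the right of the equation are smallest at the left end of [I_ N x] and largest at
    its right end. *)
Let piece_bounds i t : inJ N i -> I_ N x t ->
  g (x i) <= g (L_ N x i t) <= g (x i.+1).
Proof.
move=> iJ tI; have /andP[c0 _] := c_itv iJ.
rewrite (g_left iJ) (g_right iJ) g_eq//; apply/andP; split; apply: lerD.
- by rewrite ler_wpM2l// self_affine_ge_left.
- by rewrite q_le// x1_le.
- by rewrite ler_wpM2l// self_affine_le_right.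
- by rewrite q_le// le_xN.
Qed.

(* A bound on the possible decrease of g improves by the factor kappa each time
   the functional equation is applied. *)
Let drop_le n u v : I_ N x u -> I_ N x v -> u <= v ->
  g u - g v <= kappa ^+ n * (g (x N) - g (x 1%N)).
Proof.
have /andP[k0 k1] := kappa_01.
have B0 : 0 <= g (x N) - g (x 1%N) by rewrite subr_ge0 self_affine_le_right.
elim: n u v => [|n IH] u v uI vI uv.
  by rewrite expr0 mul1r lerB ?self_affine_le_right ?self_affine_ge_left.
have kB : 0 <= kappa ^+ n.+1 * (g (x N) - g (x 1%N)) by rewrite mulr_ge0 ?exprn_ge0.
have [i [t [iJ tI uE]]] := I_cover uI.
have [j [s [jJ sI vE]]] := I_cover vI.
have /andP[i1 iN] := iJ; have /andP[j1 jN] := jJ.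
case: (ltngtP i j) => [ij|ji|ij].
(* Distinct pieces in increasing order: node values separate [g u] from [g v], so nothing is
   lost. *)
- have /andP[_ gu] := piece_bounds iJ tI.
  have /andP[gv _] := piece_bounds jJ sI.
  apply: le_trans kB; rewrite subr_le0 uE vE (le_trans gu)// (le_trans _ gv)//.
  by apply: (nondecreasing_nodes g_nodes) => //; exact: ltnW.
(* Pieces in decreasing order although [u <= v]: the two points coincide at a common node. *)
- have /andP[xu _] := L_itv iJ tI.
  have /andP[_ vx] := L_itv jJ sI.
  have xji : x j.+1 <= x i by apply: le_nodes => //; exact: ltnW.
  have -> : u = v by apply/le_anti; rewrite uv vE uE (le_trans vx)// (le_trans xji).
  by rewrite subrr.
(* Same piece: [q i] is nondecreasing, so the drop is at most [c i <= kappa] times the drop between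
   the preimages. *)
- move: jJ vE uv; rewrite -ij uE => _ -> ; rewrite L_le// => ts.
  have /andP[c0 ck] := c_itv iJ.
  have H := ler_wpM2l c0 (IH _ _ tI sI ts).
  have Q := q_le iJ tI sI ts.
  have K : c i * (kappa ^+ n * (g (x N) - g (x 1%N))) <= kappa ^+ n.+1 * (g (x N) - g (x 1%N)).
    by rewrite exprS -mulrA ler_wpM2r// mulr_ge0 ?exprn_ge0.
  rewrite !g_eq//; lra.
Qed.

(** A positive drop would be bounded for every [n] by [kappa ^+ n] times a constant, which tends to
    0. *)
Lemma self_affine_nondecreasing : {in I_ N x &, {homo g : u v / u <= v}}.
Proof.
move=> u v; rewrite !inE => uI vI uv; rewrite leNgt; apply/negP => gvu.
have /andP[k0 k1] := kappa_01.
have : kappa ^+ n * (g (x N) - g (x 1%N)) @[n --> \oo] --> 0 * (g (x N) - g (x 1%N)).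
  by apply: cvgMl; apply: cvg_expr; rewrite ger0_norm.
rewrite mul0r => /cvgr_lt /(_ (g u - g v)); rewrite subr_gt0.
move=> /(_ gvu)[n _ /(_ n (leqnn n))] /=.
by rewrite ltNge drop_le.
Qed.

End Nodes.

(** * The equation for the derivative of the FIF, and a convexity criterion *)

Section FIF.
Variables (R : realType) (N : nat).
Implicit Types (x y d alpha r : nat -> R) (S : R -> R) (kappa : R).

(** The affine part matches the end values; the remainder is a sag whose parameters compare the
    chord slope [s] with the two end slopes. *)
Lemma P_Q_sag x y d alpha r i theta : Q_ r i theta != 0 ->
  let Y := y i - alpha i * y 1%N in
  let s := y i.+1 - alpha i * y N - Y in
  P_ N x y d alpha r i theta / Q_ r i theta =
  Y + s * theta
  - sag r i (s - (h_ x i * d i - alpha i * d 1%N * len N x))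
             (h_ x i * d i.+1 - alpha i * d N * len N x - s) theta.
Proof.
move=> Q0 /=; rewrite /sag /sag_num /P_; move: Q0; rewrite /Q_ => Q0.
by field.
Qed.

(** At [W = 0] the quotient is 0 by convention, and the product bound is trivial. *)
Lemma mulr_le_of_le_div (w V W k : R) : 0 <= W -> 0 <= V ->
  0 <= k < 1 -> 0 <= w -> w <= k * (V / W) -> w * W <= k * V.
Proof.
move=> W0 V0 /andP[k0 k1] w0; have [->|Wn0] := eqVneq W 0.
  by rewrite mulr0 mulr_ge0.
by move=> /(ler_wpM2r W0); rewrite -mulrA divfK.
Qed.

Lemma ler_div_scaled (num B h rho : R) : 0 < h -> 0 < B ->
  num / h / (B / h) <= rho -> num <= rho * B.
Proof.
by move=> h0 B0; rewrite invf_div mulrA divfK ?lt0r_neq0// ler_pdivrMr.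
Qed.

(* Here s is the increment of P_i / Q_i over [0, 1], and s - A, s + B are its
   derivatives at 0 and 1. *)
Lemma FIF_convex x y d alpha r kappa S : (2 <= N)%N ->
  (forall i, inJ N i -> x i < x i.+1) ->
  0 <= kappa < 1 ->
  (forall i, inJ N i -> 0 <= alpha i <= kappa * a_ N x i) ->
  (forall i, inJ N i -> -1 < r i) ->
  (forall i, inJ N i -> d i <= d i.+1) ->
  (forall i, inJ N i ->
    let s := y i.+1 - alpha i * y N - (y i - alpha i * y 1%N) in
    let A := s - (h_ x i * d i - alpha i * d 1%N * len N x) in
    let B := h_ x i * d i.+1 - alpha i * d N * len N x - s in
    [/\ 0 <= A, 0 <= B, A + B <= r i * A & A + B <= r i * B]) ->
  is_rational_cubic_FIF N x y d alpha r S ->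
  convex_function (I_ N x : set R^o) S.
Proof.
move=> N2 xincr k01 alphaK r1 dnd AB [[g [Sg gc]] SE].
have len0 := len_gt0 N2 xincr.
have lenn0 := lt0r_neq0 len0.
pose th (t : R) : R := (t - x 1%N) / len N x.
have th01 t : I_ N x t -> 0 <= th t <= 1.
  rewrite /I_ /= in_itv/= => /andP[t1 tN].
  rewrite /th divr_ge0 ?(ltW len0) ?subr_ge0//= ler_pdivrMr// mul1r.
  by rewrite /len lerB.
pose s i := y i.+1 - alpha i * y N - (y i - alpha i * y 1%N).
pose A i := s i - (h_ x i * d i - alpha i * d 1%N * len N x).
pose B i := h_ x i * d i.+1 - alpha i * d N * len N x - s i.
pose c i := alpha i / a_ N x i.
(* The derivative in [t] of P_i / Q_i, divided by [a_ N x i]; the factors [len N x] cancel and leave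
   [h_ x i]. *)
pose q i t := (s i - sag' r i (A i) (B i) (th t)) / h_ x i.
have gE i t : inJ N i -> I_ N x t -> g (L_ N x i t) = c i * g t + q i t.
  move=> iJ tI; have ai := a_gt0 N2 xincr iJ; have hi := h_gt0 xincr iJ.
  have Qt : Q_ r i (th t) != 0 by rewrite lt0r_neq0// Q_gt0 ?r1 ?th01.
  have lhs : derivative_within (I_ N x) (fun v => S (L_ N x i v)) t
      (a_ N x i * g (L_ N x i t)).
    apply: derivative_within_affine; first exact: lt0r_neq0.
      by move=> v; apply: L_I.
    by apply: Sg; exact: L_I.
  pose p v := y i - alpha i * y 1%N + s i * th v - sag r i (A i) (B i) (th v).
  have dth : is_derive t 1 th (len N x)^-1.
    rewrite /th; apply: is_derive_eq; rewrite /GRing.scale /=; ring.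
  have dp : is_derive t 1 p (s i * (len N x)^-1 - sag' r i (A i) (B i) (th t) * (len N x)^-1).
    have db := is_derive_sag (A i) (B i) Qt.
    have dbt : is_derive t 1 (fun v => sag r i (A i) (B i) (th v))
        (sag' r i (A i) (B i) (th t) * (len N x)^-1) := is_derive1_comp db dth.
    rewrite /p; apply: is_derive_eq; rewrite /GRing.scale /=; ring.
  have rhs := derivative_within_lin (k := alpha i) (m := 1)
    (Sg _ tI) (is_derive_within (I_ N x) dp).
  have rhs' : derivative_within (I_ N x) (fun v => S (L_ N x i v)) t
      (alpha i * g t + 1 * (s i * (len N x)^-1 - sag' r i (A i) (B i) (th t) * (len N x)^-1)).
    apply: eq_derivative_within rhs => // v vI; rewrite SE// mul1r P_Q_sag//.
    by rewrite lt0r_neq0// Q_gt0 ?r1 ?th01.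
  have x1N : x 1%N < x N by rewrite -subr_gt0.
  have E := derivative_within_unique x1N _ lhs rhs'.
  apply: (mulfI (lt0r_neq0 ai)); rewrite E//.
  rewrite /c /q /a_; field.
  by rewrite lenn0 lt0r_neq0.
have cK i : inJ N i -> 0 <= c i <= kappa.
  move=> iJ; have ai := a_gt0 N2 xincr iJ; have /andP[al0 alk] := alphaK i iJ.
  by rewrite /c divr_ge0 ?(ltW ai)//= ler_pdivrMr.
have I1 : I_ N x (x 1%N) by rewrite /I_ /= in_itv/= lexx -subr_ge0 ltW.
have IN : I_ N x (x N) by rewrite /I_ /= in_itv/= lexx andbT -subr_ge0 ltW.
have th1 : th (x 1%N) = 0 by rewrite /th subrr mul0r.
have thN : th (x N) = 1 by rewrite /th divff.
(* By the end slopes of the sag, the values [d] satisfy the same equation at the nodes as [g], so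
   their difference satisfies the homogeneous one. *)
have gl i : inJ N i -> g (x i) - d i = c i * (g (x 1%N) - d 1%N).
  move=> iJ; rewrite -{1}(L_left i lenn0) gE// /q th1 sag'0 /A /c /a_.
  by field; rewrite lenn0 lt0r_neq0 // (h_gt0 xincr iJ).
have gr i : inJ N i -> g (x i.+1) - d i.+1 = c i * (g (x N) - d N).
  move=> iJ; rewrite -{1}(L_right i lenn0) gE// /q thN sag'1 /B /c /a_.
  by field; rewrite lenn0 lt0r_neq0 // (h_gt0 xincr iJ).
have fixed0 k z : inJ N k -> z = c k * z -> z = 0.
  move=> kJ zE; have /andP[_ ck] := cK k kJ; have /andP[_ k1] := k01.
  have : (1 - c k) * z = 0 by rewrite mulrBl mul1r -zE subrr.
  by move/eqP; rewrite mulf_eq0 => /orP[/eqP|/eqP//]; lra.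
have J1 : inJ N 1 by rewrite /inJ.
have JN : inJ N N.-1 by rewrite /inJ -ltnS !prednK ?leqnn ?andbT// ltnW.
have NE : N.-1.+1 = N by rewrite prednK// ltnW.
(* On the first and last pieces the deviation at an end of [I_ N x] is a fixed point of a
   contraction, hence 0; it then vanishes at every node. *)
have g1 : g (x 1%N) - d 1%N = 0 := fixed0 _ _ J1 (gl _ J1).
have gN : g (x N) - d N = 0 by apply: (fixed0 _ _ JN); rewrite -gr// NE.
have gnodes i : inJ N i -> g (x i) <= g (x i.+1).
  move=> iJ; have := gl i iJ; have := gr i iJ; rewrite g1 gN !mulr0.
  by move=> /subr0_eq-> /subr0_eq->; exact: dnd.
have qnd i : inJ N i -> {in I_ N x &, {homo q i : u v / u <= v}}.
  move=> iJ u v; rewrite !inE => uI vI uv.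
  have [A0 B0 rA rB] := AB i iJ; have hi := h_gt0 xincr iJ.
  rewrite ler_wpM2r ?invr_ge0 ?(ltW hi)// lerD2l lerN2.
  apply: sag'_nincr => //; rewrite ?r1 ?in_itv/= ?th01//.
  by rewrite ler_wpM2r ?invr_ge0 ?(ltW len0)// lerD2r.
apply: (convex_function_itv (df := g)) => [|u uI|].
- by rewrite -subr_gt0.
- exact: Sg.
- move=> u v uI vI.
  by apply: (self_affine_nondecreasing N2 xincr k01 cK gc gE qnd gnodes); rewrite inE.
Qed.

(** * From the stated parameter bounds to the criterion *)

Lemma end_slopes_chord x y d : (2 <= N)%N ->
  (forall i, inJ N i -> x i < x i.+1) -> convex_slopes N x y d ->
  d 1%N * len N x <= y N - y 1%N <= d N * len N x.
Proof.
move=> N2 xincr slopes.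
have dnd i : inJ N i -> d i <= d i.+1.
  by move=> /slopes /andP[/ltW d1 /ltW d2]; exact: le_trans d1 d2.
have yE i : inJ N i -> y i.+1 - y i = Delta_ x y i * h_ x i.
  by move=> iJ; rewrite divfK// lt0r_neq0 // (h_gt0 xincr iJ).
have le1N := nondecreasing_nodes _ (isT : (1 <= 1)%N) (ltnW N2) (leqnn N).
apply/andP; split.
(* Every chord slope is at least d_1, so the tilted ordinates y_i - d_1 x_i are nondecreasing; the
   other bound uses d_N x_i - y_i. *)
- have := le1N R (fun i => y i - d 1%N * x i); rewrite /len => H.
  suff : y 1%N - d 1%N * x 1%N <= y N - d 1%N * x N by lra.
  apply: H => i iJ; have /andP[i1 iN] := iJ.
  have dd : d 1%N <= d i by apply: (nondecreasing_nodes dnd) => //; exact: ltnW.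
  have /andP[/ltW di _] := slopes i iJ.
  have := yE i iJ; have := ler_wpM2r (ltW (h_gt0 xincr iJ)) (le_trans dd di).
  by rewrite /h_; lra.
- have := le1N R (fun i => d N * x i - y i); rewrite /len => H.
  suff : d N * x 1%N - y 1%N <= d N * x N - y N by lra.
  apply: H => i iJ; have /andP[i1 iN] := iJ.
  have dd : d i.+1 <= d N by apply: (nondecreasing_nodes dnd).
  have /andP[_ /ltW di] := slopes i iJ.
  have := yE i iJ; have := ler_wpM2r (ltW (h_gt0 xincr iJ)) (le_trans di dd).
  by rewrite /h_; lra.
Qed.

(** The bounds on [alpha] make the sag parameters [A] and [B] positive; those on [r] then say that
    [r i] is at least [(A + B) / A] and [(A + B) / B]. *)
Lemma rational_cubic_FIF_convex x y d alpha r kappa kappaU kappaL S :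
  (2 <= N)%N ->
  (forall i, inJ N i -> x i < x i.+1) ->
  0 <= kappa < 1 -> 0 <= kappaU < 1 -> 0 <= kappaL < 1 ->
  (forall i, inJ N i -> -1 < r i) ->
  is_rational_cubic_FIF N x y d alpha r S ->
  (forall i, inJ N i -> 0 <= alpha i <= alpha_bound N x y d kappa kappaU kappaL i) ->
  (forall i, inJ N i -> r_bound N x y d alpha i <= r i) ->
  convex_slopes N x y d ->
  convex_function (I_ N x : set R^o) S.
Proof.
move=> N2 xincr k01 kU01 kL01 r1 SF alphaB rB slopes.
have /andP[WL WU] := end_slopes_chord N2 xincr slopes.
apply: (FIF_convex N2 xincr k01 _ r1 _ _ SF) => i iJ.
(* Since [a_ N x i <= 1], its square in the bound may be replaced by its first power. *)
- have := alphaB i iJ; rewrite /alpha_bound !le_min => /andP[-> /andP[ak _]] /=.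
  have ai := a_gt0 N2 xincr iJ; have a1 := a_le1 N2 xincr iJ.
  have /andP[k0 _] := k01.
  by apply: le_trans ak _; rewrite ler_wpM2l// expr2 ger_pMl.
- by have /andP[/ltW d1 /ltW d2] := slopes i iJ; exact: le_trans d1 d2.
have := alphaB i iJ; rewrite /alpha_bound !le_min.
move=> /andP[al0 /andP[_ /andP[alU alL]]].
have h0 := h_gt0 xincr iJ; have /andP[dL dU] := slopes i iJ.
have VL : 0 < h_ x i * (Delta_ x y i - d i) by rewrite mulr_gt0// subr_gt0.
have VU : 0 < h_ x i * (d i.+1 - Delta_ x y i) by rewrite mulr_gt0// subr_gt0.
rewrite -subr_ge0 in WL; rewrite -subr_ge0 in WU.
have bL := mulr_le_of_le_div WL (ltW VL) kL01 al0 alL.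
have bU := mulr_le_of_le_div WU (ltW VU) kU01 al0 alU.
set s := y i.+1 - _ - _; set A := s - _; set B := _ - s.
have hD : h_ x i * Delta_ x y i = y i.+1 - y i by rewrite mulrC divfK// lt0r_neq0.
have AE : A = h_ x i * (Delta_ x y i - d i) - alpha i * (y N - y 1%N - d 1%N * len N x).
  by rewrite /A /s (mulrBr (h_ x i)) hD; ring.
have BE : B = h_ x i * (d i.+1 - Delta_ x y i) - alpha i * (d N * len N x - (y N - y 1%N)).
  by rewrite /B /s (mulrBr (h_ x i)) hD; ring.
(* [A] is a positive quantity minus at most [kappaL < 1] times itself; likewise [B] with
   [kappaU]. *)
have A0 : 0 < A by have /andP[_ kL1] := kL01; nra.
have B0 : 0 < B by have /andP[_ kU1] := kU01; nra.
have := rB i iJ; rewrite /r_bound ge_max => /andP[rU rL].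
have hn0 := lt0r_neq0 h0.
have numE : d i.+1 - d i + alpha i / h_ x i * len N x * (d 1%N - d N) = (A + B) / h_ x i.
  by rewrite AE BE; field.
have denL : Delta_ x y i - d i
    - alpha i / h_ x i * (y N - y 1%N - d 1%N * len N x) = A / h_ x i.
  by rewrite AE; field.
have denU : d i.+1 - Delta_ x y i
    - alpha i / h_ x i * (d N * len N x - (y N - y 1%N)) = B / h_ x i.
  by rewrite BE; field.
rewrite numE denL in rL; rewrite numE denU in rU.
split; [exact: ltW|exact: ltW|exact: ler_div_scaled rL|exact: ler_div_scaled rU].
Qed.

(** * Symmetry under negation, for the concave case *)

Lemma is_rational_cubic_FIFN x y d alpha r S :
  is_rational_cubic_FIF N x y d alpha r S ->
  is_rational_cubic_FIF N x (\- y) (\- d) alpha r (\- S).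
Proof.
move=> [[g [Sg gc]] SE]; split.
  exists (\- g); split.
    move=> u uI; have F : Filter (within (I_ N x) u^') by exact: within_filter.
    have H : - ((S t - S u) / (t - u)) @[t --> within (I_ N x) u^'] --> - g u.
      by apply: cvgN; exact: Sg.
    apply: cvg_trans H; apply: near_eq_cvg; apply: nearW => t /=.
    by rewrite -mulNr opprB opprK addrC.
  by move=> u; exact/continuousN/gc.
move=> i t iJ tI theta; rewrite /= SE// opprD -mulrN -mulNr; congr (_ + _ / _).
(* [P_] is linear in [y] and [d] jointly, while [Q_] does not involve them. *)
by rewrite /P_ /= -/theta; ring.
Qed.

Lemma Delta_N x y i : Delta_ x (\- y) i = - Delta_ x y i.
Proof. by rewrite /Delta_ /= -opprD mulNr. Qed.

(** In each quotient, numerator and denominator change sign together. *)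
Lemma alpha_boundN x y d kappa kappaU kappaL :
  alpha_bound N x (\- y) (\- d) kappa kappaU kappaL =1
  alpha_bound N x y d kappa kappaU kappaL.
Proof.
move=> i; rewrite /alpha_bound !Delta_N /=.
congr (Num.min _ (Num.min (_ * _) (_ * _)));
  rewrite -[RHS]divrNN; congr (_ / _); ring.
Qed.

Lemma r_boundN x y d alpha :
  r_bound N x (\- y) (\- d) alpha =1 r_bound N x y d alpha.
Proof.
move=> i; rewrite /r_bound !Delta_N /=.
congr (Num.max _ _); rewrite -[RHS]divrNN; congr (_ / _); ring.
Qed.

End FIF.

Unset Implicit Arguments.

Theorem theorem4p2 (R : realType) (N : nat) (x y d alpha r : nat -> R)
    (kappa kappaU kappaL : R) (S : R -> R)
    (N_ge2 : (2 <= N)%N)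
    (x_incr : forall i, inJ N i -> x i < x i.+1)
    (kappa_01 : 0 <= kappa < 1)
    (kappaU_01 : 0 <= kappaU < 1)
    (kappaL_01 : 0 <= kappaL < 1)
    (alpha_adm : forall i, inJ N i -> `|alpha i| <= kappa * a_ N x i)
    (r_adm : forall i, inJ N i -> -1 < r i)
    (S_FIF : is_rational_cubic_FIF N x y d alpha r S)
    (alpha_cond : forall i, inJ N i ->
       0 <= alpha i <= alpha_bound N x y d kappa kappaU kappaL i)
    (r_cond : forall i, inJ N i -> r_bound N x y d alpha i <= r i) :
  (convex_data N x y -> convex_slopes N x y d ->
     convex_function (I_ N x : set R^o) S) /\
  (concave_data N x y -> concave_slopes N x y d ->
     concave_function (I_ N x : set R^o) S).
Proof.
split=> _ slopes; first exact: (rational_cubic_FIF_convex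
  N_ge2 x_incr kappa_01 kappaU_01 kappaL_01 r_adm S_FIF alpha_cond r_cond).
apply: (rational_cubic_FIF_convex (y := \- y) (d := \- d) (alpha := alpha)
  (r := r) N_ge2 x_incr kappa_01 kappaU_01 kappaL_01 r_adm).
- exact: is_rational_cubic_FIFN.
- by move=> i iJ; rewrite alpha_boundN alpha_cond.
- by move=> i iJ; rewrite r_boundN r_cond.
- by move=> i iJ; rewrite Delta_N /= !ltrN2 andbC slopes.
Qed.
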